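(* Let $\mathbb H^d$ denote real hyperbolic $d$-space. Then $\mathrm{TO}^q_{\mathbb{H}^d}(r) \lesssim r^{1-1/(d-q)}$ for $2 \leq q \leq d-2$, and $\mathrm{TO}^{d-1}_{\mathbb{H}^d}(r)\lesssim \ln(1+r)^2$.
   Context: For a metric space $X$ and $Z\subseteq X$, $\mathrm{Cov}^1(Z)$ is the minimal number of closed radius-$1$ balls of $X$ covering $Z$. For continuous $f:Z\to\mathbb R^q$, $\mathrm{Ov}(f)=\sup_{z}\mathrm{Cov}^1(f^{-1}(z))$, $\mathrm{TO}^q(Z)=\min_f\mathrm{Ov}(f)$, $\mathrm{TO}^q_X(r)=\max\{\mathrm{TO}^q(Z): Z\subseteq X,\mathrm{Cov}^1(Z)\le r\}$. $f\lesssim g$ means there is $C$ with $f(r)\le Cg(Cr)+C$ for all $r$. *)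

(* Defs.v *)
From HB Require Import structures.
From mathcomp Require Import all_boot all_order all_algebra.
From mathcomp Require Import all_classical all_reals all_analysis.
From mathcomp Require Import Rstruct Rstruct_topology.
Unset Printing Implicit Defensive.
Import Order.TTheory GRing.Theory Num.Theory.
Local Open Scope classical_set_scope.
Local Open Scope ring_scope.

Notation R := Rdefinitions.R.

Definition lor (d : nat) (x y : R * 'rV[R]_d) : R :=
  x.1 * y.1 - \sum_(i < d) x.2 0 i * y.2 0 i.

(* Hyperboloid model of real hyperbolic d-space H^d (upper sheet). *)
Definition Hyp (d : nat) : set (R * 'rV[R]_d) :=
  [set x | 0 < x.1 /\ @lor d x x = 1].

(* Hyperbolic distance: arcosh of the Lorentz product. *)
Definition hdist (d : nat) (x y : R * 'rV[R]_d) : R :=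
  ln (@lor d x y + Num.sqrt (@lor d x y ^+ 2 - 1)).

Definition edist (q : nat) (u v : 'rV[R]_q) : R :=
  Num.sqrt (\sum_(i < q) (u 0 i - v 0 i) ^+ 2).

Definition covered_by (d : nat) (Z : set (R * 'rV[R]_d)) (n : nat) : Prop :=
  exists cs : seq (R * 'rV[R]_d),
    (size cs <= n)%N /\ (forall c, c \in cs -> Hyp d c) /\
    (forall z, Z z -> exists2 c, c \in cs & @hdist d c z <= 1).

(* Cov^1(Z): minimal number of closed unit balls covering Z (+oo if none). *)
Definition Cov1 (d : nat) (Z : set (R * 'rV[R]_d)) : \bar R :=
  ereal_inf [set (n%:R)%:E | n in [set n | covered_by d Z n]].

Definition cont_on (d q : nat) (Z : set (R * 'rV[R]_d))
    (f : R * 'rV[R]_d -> 'rV[R]_q) : Prop :=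
  forall x, Z x -> forall eps : R, 0 < eps -> exists2 del : R, 0 < del &
    forall y, Z y -> @hdist d x y < del -> @edist q (f x) (f y) < eps.

Definition Ov (d q : nat) (Z : set (R * 'rV[R]_d))
    (f : R * 'rV[R]_d -> 'rV[R]_q) : \bar R :=
  ereal_sup [set @Cov1 d [set x | Z x /\ f x = z] | z in [set: 'rV[R]_q]].

Definition TO (d q : nat) (Z : set (R * 'rV[R]_d)) : \bar R :=
  ereal_inf [set @Ov d q Z f | f in [set f | @cont_on d q Z f]].

Definition TOX (d q : nat) (r : R) : \bar R :=
  ereal_sup [set @TO d q Z | Z in [set Z | Z `<=` Hyp d /\ (@Cov1 d Z <= r%:E)%E]].

Definition lesssim (F : R -> \bar R) (g : R -> R) : Prop :=
  exists C : R, 0 < C /\ forall r : R, 0 <= r -> (F r <= (C * g (C * r) + C)%:E)%E.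

(* Main.v *)
Require Import Defs.
From HB Require Import structures.
From mathcomp Require Import all_boot all_order all_algebra.
From mathcomp Require Import all_classical all_reals all_analysis.
From mathcomp Require Import Rstruct Rstruct_topology.
From mathcomp Require Import zify ring lra.
Set Implicit Arguments.
Unset Strict Implicit.
Unset Printing Implicit Defensive.
Import Order.TTheory GRing.Theory Num.Theory.
Import numFieldNormedType.Exports.
Local Open Scope classical_set_scope.
Local Open Scope ring_scope.

(** In the upper half-space model put [m = d - q].  Fixing [q - 1] of the horizontal
    coordinates cuts out isometric copies of H^(m+1), and forgetting these
    coordinates maps H^d to H^(m+1) without increasing distances.  Hence, if the
    level sets of a function [h] on H^(m+1) meet few unit-size cells of the
    projection of Z, pairing the forgotten coordinates with [h] gives a map
    Z -> R^q with small fibres, and the problem reduces to q = 1.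

    In H^(m+1), let P be a set of N dyadic cells.  Take the smallest dyadic s for
    which some box [max(y, |x - a|) <= s] contains a fixed proportion of P; by
    minimality, the box of twice the size misses a fixed proportion of P.  Among N
    parallel shells between the two boxes, one meets at most the average number of
    cells.  A cell of size [2^-i s] meets about a proportion [2^-i] of the shells
    and there are O(2^(im)) such cells near the box, so this average is
    O(N^(1-1/m)) for m >= 2 and O(ln N) for m = 1.  Sweep the inside of the shell
    first, then the outside, recursively: the costs form a geometric series when
    m >= 2, and sum to O((ln N)^2) when m = 1. *)

(** * Counting and norms *)

Lemma exists_int_window (K : archiRealFieldType) (a w : K) (k : nat) : w < k%:R ->
  exists b : int, forall j : int, a <= j%:~R <= a + w ->
    exists t : 'I_k, j = b + (t : nat)%:Z.
Proof.
move=> wk; exists (Num.ceil a) => j /andP[aj jw].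
have bj : Num.ceil a <= j by rewrite Num.Theory.ceil_le_int.
have ceil_a := Num.Theory.ceil_ge a.
have jk : j - Num.ceil a < k%:Z.
  by rewrite -(ltr_int K) rmorphB /= -pmulrn; lra.
have tk : (`|j - Num.ceil a| < k)%N by lia.
by exists (Ordinal tk) => /=; lia.
Qed.

Lemma card_ord_window_le (K : archiRealFieldType) (N : nat) (a w : K) : 0 <= w ->
  #|[pred j : 'I_N | a <= (j : nat)%:R <= a + w]|%:R <= w + 1.
Proof.
move=> w_ge0; pose k := (Num.truncn w).+1.
have wk : w < k%:R by rewrite /k -Num.Theory.truncn_lt_nat.
have kw : k%:R <= w + 1 by rewrite /k -natr1 lerD2r Num.Theory.truncn_le.
apply: le_trans kw; rewrite ler_nat; have [b bP] := exists_int_window a wk.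
rewrite cardE -(size_map (fun j : 'I_N => (j : nat)%:Z)).
rewrite -[leqRHS](size_enum_ord k) -(size_map (fun t : 'I_k => b + (t : nat)%:Z)).
apply: uniq_leq_size.
  by rewrite map_inj_uniq ?enum_uniq// => i j [/ord_inj].
move=> z /mapP[j]; rewrite mem_enum inE pmulrn => /bP[t jt ->]; rewrite jt.
by apply/mapP; exists t => //; exact: mem_enum.
Qed.

Lemma exists_unit_interval (K : archiRealFieldType) (k : nat) (t : K) :
  0 <= t <= k.+1%:R -> exists u : 'I_k.+1, `|t - (u : nat)%:R - 1 / 2| <= 1 / 2.
Proof.
move=> /andP[t_ge0 tk]; have [lt_tk|ge_tk] := ltnP (Num.truncn t) k.+1.
  have trunc_le : (Num.truncn t)%:R <= t by rewrite Num.Theory.truncn_le.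
  have lt_truncS := Num.Theory.truncnS_gt t; rewrite -natr1 in lt_truncS.
  by exists (Ordinal lt_tk) => /=; rewrite ler_norml; apply/andP; split; lra.
have kt : k.+1%:R <= t by rewrite -Num.Theory.truncn_ge_nat.
rewrite -natr1 in tk kt.
by exists ord_max => /=; rewrite ler_norml; apply/andP; split; lra.
Qed.

Lemma exists_dyadic_level (K : realType) (y : K) : 0 < y ->
  exists n : int, 2 ^ n <= y < 2 * 2 ^ n.
Proof.
move=> y_gt0; have ln2_gt0 : 0 < ln (2 : K) by rewrite ln_gt0// ltr1n.
have pow2E (k : int) : (2 : K) ^ k = expR (k%:~R * ln 2).
  by rewrite -powR_intmul// /powR pnatr_eq0.
have /andP[] := Num.Theory.floor_itv (ln y / ln 2).
set n := Num.floor _ => floor_le lt_floor; exists n.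
have -> : 2 * 2 ^ n = 2 ^ (n + 1) :> K by rewrite addrC expfzDr.
rewrite !pow2E -{1 2}(lnK y_gt0) ler_expR ltr_expR.
by rewrite -ler_pdivlMr// floor_le -ltr_pdivrMr.
Qed.

Lemma expR1_le4 (K : realType) : expR 1 <= 4 :> K.
Proof.
have expR_half : expR (1 / 2) <= 2 :> K.
  rewrite -[leLHS]invrK -expRN -[leRHS]invrK lef_pV2 ?posrE ?expR_gt0 ?invr_gt0//.
  by apply: le_trans (expR_ge1Dx _); lra.
have -> : 4 = 2 * 2 :> K by rewrite -natrM.
by rewrite [1 in leLHS](splitr 1) exp.expRD ler_pM ?expR_ge0.
Qed.

Lemma natr_count (K : pzSemiRingType) (T : Type) (p : pred T) (P : seq T) :
  (count p P)%:R = \sum_(Q <- P) (p Q)%:R :> K.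
Proof. by elim: P => [|Q P IH]; rewrite ?big_nil// big_cons /= natrD IH. Qed.

Lemma count_le_cover (T : Type) (I : finType) (p b : pred T) (f : I -> pred T)
    (P : seq T) :
  (forall Q, p Q -> b Q || [exists t, f t Q]) ->
  (count p P <= count b P + \sum_t count (f t) P)%N.
Proof.
move=> pbf; elim: P => [|Q P IH] //=; rewrite big_split /= addnACA leq_add//.
case: (boolP (p Q)) => // /pbf /orP[->//|/existsP[t ft]].
by rewrite (bigD1 t)//= ft addnCA.
Qed.

Lemma exists_le_mean (K : realDomainType) (I : finType) (u : I -> K) (A : K) :
  (0 < #|I|)%N -> \sum_i u i <= #|I|%:R * A -> exists i, u i <= A.
Proof.
move=> /card_gt0P[i0 _] uA; apply: contrapT => /forallNP gtA.
have : \sum_(i : I) A < \sum_i u i.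
  apply: ltr_sum => [|i _]; last by have /negP := gtA i; rewrite -ltNge.
  by apply/hasP; exists i0; rewrite ?mem_index_enum.
by rewrite sumr_const -mulr_natl ltNge uA.
Qed.

Lemma size_flatten_map_le (T U : Type) (f : T -> seq U) (s : seq T) (M : nat) :
  (forall t, size (f t) <= M)%N -> (size (flatten (map f s)) <= size s * M)%N.
Proof.
by move=> fM; elim: s => [|t s IH] //=; rewrite size_cat mulSn leq_add.
Qed.

Lemma geometric_sum_le (K : numDomainType) (b : K) (I : nat) : 2 <= b ->
  \sum_(i < I.+1) b ^+ i <= 2 * b ^+ I.
Proof.
move=> b_ge2; have b_ge0 : 0 <= b by apply: le_trans b_ge2.
elim: I => [|I IH]; first by rewrite big_ord1 expr0 mulr1 ler1n.
rewrite big_ord_recr /= mulr2n mulrDl mul1r lerD2r (le_trans IH)// exprS.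
by rewrite ler_wpM2r// exprn_ge0.
Qed.

Section row_vector_norm.
Context (K : realFieldType) (n : nat).
Implicit Types v : 'rV[K]_n.

Lemma rV_norm_le v (s : K) : 0 <= s ->
  reflect (forall i, `|v 0 i| <= s) (`|v| <= s).
Proof.
move=> s_ge0; rewrite [`|v|]mx_normrE; apply: (iffP (bigmax_leP _ _ _ _)).
  by move=> [_ vs] i; apply: (vs (0, i)).
by move=> vs; split=> // -[i j] _; rewrite ord1.
Qed.

Lemma coord_le_rV_norm v i : `|v 0 i| <= `|v|.
Proof. exact/rV_norm_le. Qed.

Lemma sum_sqr_le_rV_norm v : \sum_i v 0 i ^+ 2 <= n%:R * `|v| ^+ 2.
Proof.
rewrite -[n in n%:R]card_ord mulr_natl -sumr_const; apply: ler_sum => i _.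
by rewrite -real_normK ?num_real// lerXn2r ?nnegrE// coord_le_rV_norm.
Qed.

Lemma sqr_rV_norm_le_sum v : `|v| ^+ 2 <= \sum_i v 0 i ^+ 2.
Proof.
have sum_ge0 (p : pred 'I_n) : 0 <= \sum_(i | p i) v 0 i ^+ 2.
  by apply: sumr_ge0 => i _; rewrite sqr_ge0.
have [->|/mx_norm_neq0[[i0 i] /= vE]] := eqVneq `|v| 0; first by rewrite expr0n.
rewrite [`|v|]vE ord1 real_normK ?num_real// (bigD1 i)//=.
by rewrite lerDl.
Qed.

Lemma sqr_pair_norm_le_sum (u : 'rV[K]_n * K) :
  `|u| ^+ 2 <= \sum_i u.1 0 i ^+ 2 + u.2 ^+ 2.
Proof.
have rV_le := sqr_rV_norm_le_sum u.1.
have rV_ge0 : 0 <= `|u.1| ^+ 2 by rewrite exprn_ge0.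
rewrite prod_normE -[u.2 ^+ 2]real_normK ?num_real//.
have num_ge0 : 0 <= `|u.2| ^+ 2 by rewrite exprn_ge0.
by rewrite /Num.max; case: ifP => _; lra.
Qed.

End row_vector_norm.

(** * Cells of the upper half-space *)

Section half_space_cells.
Context (K : realType) (m : nat).
Local Notation point := ('rV[K]_m * K)%type.
Implicit Types (p : point) (a : 'rV[K]_m).

(* The upper half-space is cut into boxes of height comparable to their distance
   to the boundary; [(n, j)] is the box of level [n] above the [j]-th cube of
   side [2 ^ n / (m + 1)].  The factor [m + 1] makes every box fit in a hyperbolic
   unit ball. *)
Definition cell : Type := int * 'rV[int]_m.

Implicit Types (Q : cell) (P : seq cell).

Definition side Q : K := 2 ^ Q.1.

Definition mesh Q : K := side Q / m.+1%:R.

Definition center Q : point :=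
  (mesh Q *: \row_i ((Q.2 0 i)%:~R + 1 / 2), 3 / 2 * side Q).

Definition region Q : set point :=
  [set p | `|p.1 - (center Q).1| <= mesh Q / 2 /\
           `|p.2 - (center Q).2| <= side Q / 2].

Lemma side_gt0 Q : 0 < side Q.
Proof. by rewrite /side exprz_gt0. Qed.

Lemma mesh_gt0 Q : 0 < mesh Q.
Proof. by rewrite divr_gt0// side_gt0. Qed.

Lemma mesh_le_side Q : mesh Q <= side Q.
Proof. by rewrite ler_pdivrMr// ler_peMr ?(ltW (side_gt0 Q))// ler1n. Qed.

Lemma sum_sqr_le_side Q a : `|a| <= mesh Q / 2 ->
  \sum_i a 0 i ^+ 2 <= side Q ^+ 2 / 4.
Proof.
move=> a_le; have mesh_Q := mesh_gt0 Q.
have m_le : m%:R <= m.+1%:R ^+ 2 :> K.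
  by rewrite -natrX ler_nat -mulnn (leq_trans (leqnSn m))// leq_pmulr.
have mesh_side : mesh Q * m.+1%:R = side Q by rewrite mulfVK.
apply: le_trans (sum_sqr_le_rV_norm a) _.
apply: (@le_trans _ _ (m%:R * (mesh Q / 2) ^+ 2)).
  by rewrite ler_wpM2l// lerXn2r ?nnegrE// divr_ge0// ltW.
by rewrite -mesh_side; have := ler_wpM2r (sqr_ge0 (mesh Q)) m_le; lra.
Qed.

Lemma exists_region p : 0 < p.2 -> exists Q, region Q p.
Proof.
move=> /exists_dyadic_level[n /andP[n_le lt_n]].
pose w : K := 2 ^ n / m.+1%:R; have w_gt0 : 0 < w by rewrite divr_gt0 ?exprz_gt0.
exists (n, \row_i Num.floor (p.1 0 i / w)); split; last first.
  by rewrite /center /side ler_norml /=; apply/andP; split; lra.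
rewrite /center /mesh /side /= -/w; apply/rV_norm_le => [|i].
  by rewrite divr_ge0// ltW.
have /andP[] := Num.Theory.floor_itv (p.1 0 i / w).
rewrite rmorphD /= !mxE ler_pdivlMr// ltr_pdivrMr// => ? ?.
by rewrite ler_norml; apply/andP; split; lra.
Qed.

Lemma dist_center_le Q p : region Q p -> `|p - center Q| <= side Q / 2.
Proof.
move=> [p1_le p2_le]; rewrite prod_normE ge_max p2_le andbT (le_trans p1_le)//.
by rewrite ler_pM2r ?invr_gt0// mesh_le_side.
Qed.

Lemma exists_level_cells (n : int) a (D : K) (k : nat) :
  2 * D * m.+1%:R < k%:R * 2 ^ n ->
  exists2 cs : seq cell, size cs = (k ^ m)%N &
    forall Q, Q.1 = n -> `|(center Q).1 - a| <= D -> Q \in cs.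
Proof.
move=> Dk; pose w : K := 2 ^ n / m.+1%:R.
have w_gt0 : 0 < w by rewrite divr_gt0 ?exprz_gt0.
have wk : 2 * D / w < k%:R by rewrite invf_div mulrA ltr_pdivrMr ?exprz_gt0.
have [b bP] := choice (fun i => exists_int_window ((a 0 i - D) / w - 1 / 2) wk).
exists [seq (n, \row_i (b i + (t 0 i : nat)%:Z)) | t : 'rV['I_k]_m].
  by rewrite size_map -cardE card_mx card_ord mul1n.
move=> [n' j] /= ->{n'} near_a.
have /choice[t tP] : forall i, exists u : 'I_k, j 0 i = b i + (u : nat)%:Z.
  move=> i; apply: bP; rewrite lerBlDr ler_pdivrMr//.
  rewrite [X in _ && (_ <= X)](_ : _ = (a 0 i + D) / w - 1 / 2); last first.
    by field; rewrite gt_eqF.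
  rewrite lerBrDr ler_pdivlMr//.
  have := le_trans (coord_le_rV_norm _ i) near_a.
  by rewrite /mesh /side /= -/w !mxE ler_norml => /andP[? ?]; apply/andP; split; lra.
apply/mapP; exists (\row_i t i); first by rewrite mem_enum.
by congr pair; apply/rowP => i; rewrite !mxE tP.
Qed.

Lemma count_level_le P (n : int) a (D : K) (k : nat) : uniq P ->
  2 * D * m.+1%:R < k%:R * 2 ^ n ->
  (count (fun Q => (Q.1 == n) && (`|(center Q).1 - a| <= D)%R) P <= k ^ m)%N.
Proof.
move=> uP /exists_level_cells -/(_ a)[cs <- csP]; rewrite -size_filter.
apply: uniq_leq_size; first exact: filter_uniq.
by move=> Q; rewrite mem_filter => /andP[/andP[/eqP Qn Qa] _]; apply: csP.
Qed.

(* The constants [7] and [8] below are those of [hdist_le1_chart]; under them a ball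
   meets 8 levels. *)
Definition ball_cell_number : nat := 8 * (450 * m.+1).+1 ^ m.

Lemma region_level (n : int) p Q (u : point) : 2 ^ n <= u.2 < 2 * 2 ^ n ->
  `|u - p| <= 7 * u.2 -> u.2 <= 8 * p.2 -> region Q p -> n - 4 <= Q.1 < n + 4.
Proof.
move=> /andP[n_le lt_n] near_u le_p [_].
rewrite ler_norml /= => /andP[side_le le_side].
have : `|u.2 - p.2| <= 7 * u.2.
  by rewrite (le_trans _ near_u)// [leRHS]prod_normE le_max lexx orbT.
rewrite ler_norml => /andP[p_le _].
apply/andP; split.
  by rewrite -(@ler_eXz2l K 2) ?ltr1n// expfzDr// -exprnN -/(side Q); lra.
rewrite -(@ltr_eXz2l K 2) ?ltr1n// expfzDr// -/(side Q).
by rewrite -[X in _ < _ * X]/((2 : K) ^+ 4); lra.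
Qed.

Lemma exists_ball_cells (u : point) : 0 < u.2 ->
  exists2 cs : seq cell, (size cs <= ball_cell_number)%N &
    forall p Q, `|u - p| <= 7 * u.2 -> u.2 <= 8 * p.2 -> region Q p -> Q \in cs.
Proof.
move=> /exists_dyadic_level[n n_itv].
pose level (e : 'I_8) : int := n - 4 + (e : nat)%:Z.
have level_gt0 e : 0 < (2 : K) ^ level e by rewrite exprz_gt0.
have window_width e :
    2 * (225 * 2 ^ level e) * m.+1%:R < (450 * m.+1).+1%:R * (2 : K) ^ level e.
  by rewrite -[(450 * _).+1%:R]natr1 natrM; have := level_gt0 e; lra.
have /choice[cs csP] :=
  fun e => (exists2P _ _).1 (exists_level_cells u.1 (window_width e)).
exists (flatten [seq cs e | e <- enum 'I_8]).
  have size_cs e : (size (cs e) <= (450 * m.+1).+1 ^ m)%N by have [->] := csP e.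
  by rewrite (leq_trans (size_flatten_map_le _ size_cs))// size_enum_ord.
move=> p Q near_u le_p Qp.
have /andP[n_le lt_n] := region_level n_itv near_u le_p Qp.
have lt8 : (`|(Q.1 - (n - 4))%R| < 8)%N by lia.
pose e : 'I_8 := Ordinal lt8; have Qe : Q.1 = level e by rewrite /level /=; lia.
apply/flattenP; exists (cs e); first by rewrite map_f// mem_enum.
have [_] := csP e; apply=> //; rewrite -Qe -/(side Q).
have u2_le : u.2 <= 32 * side Q.
  have : 2 ^ (n - 4) <= side Q by rewrite ler_eXz2l ?ltr1n.
  by rewrite expfzDr// -exprnN; case/andP: n_itv; lra.
have [Qp1 _] := Qp; have mesh_le := mesh_le_side Q.
have u1_near : `|p.1 - u.1| <= 7 * u.2.
  by rewrite distrC (le_trans _ near_u)// [leRHS]prod_normE le_max lexx.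
have := ler_distD p.1 (center Q).1 u.1; rewrite [`|_.1 - p.1|]distrC => dist_le.
by have := side_gt0 Q; lra.
Qed.

Definition gauge a p : K := `|p - (a, 0)|.

Lemma gauge_le a p (s : K) : 0 <= p.2 ->
  (gauge a p <= s) = (`|p.1 - a| <= s) && (p.2 <= s).
Proof. by move=> p2_ge0; rewrite /gauge prod_normE ge_max /= subr0 ger0_norm. Qed.

Lemma center2_gt0 Q : 0 < (center Q).2.
Proof. by rewrite mulr_gt0// side_gt0. Qed.

Lemma gauge_center_le a Q (s : K) : (gauge a (center Q) <= s) =
  (`|(center Q).1 - a| <= s) && (3 / 2 * side Q <= s).
Proof. exact/gauge_le/ltW/center2_gt0. Qed.

Lemma le_gauge_center a Q : 3 / 2 * side Q <= gauge a (center Q).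
Proof.
by have := lexx (gauge a (center Q)); rewrite {1}gauge_center_le => /andP[].
Qed.

Lemma gauge_region a Q p : region Q p ->
  gauge a (center Q) - side Q / 2 <= gauge a p <= gauge a (center Q) + side Q / 2.
Proof.
move=> /dist_center_le; rewrite -ler_distl; apply: le_trans.
apply: le_trans (ler_dist_dist _ _) _; rewrite opprB addrA.
by rewrite addrNK.
Qed.

(** * Separating shells *)

Definition box_count P a (s : K) : nat :=
  count (fun Q => gauge a (center Q) <= s)%R P.

Lemma box_count_eq_size P : exists n : int, box_count P 0 (2 ^ n) = size P.
Proof.
pose M := \big[Num.max/1]_(Q <- P) gauge 0 (center Q).
have M_ge1 : 1 <= M by exact: bigmax_ge_id.
have [n /andP[_ M_lt]] := exists_dyadic_level (lt_le_trans ltr01 M_ge1).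
exists (n + 1); apply/eqP; rewrite -all_count; apply/allP => Q QP.
have QM : gauge 0 (center Q) <= M by apply: bigmax_sup_seq QP _ _.
by rewrite addrC expfzDr// (le_trans QM)// ltW.
Qed.

Lemma box_count_eq0 P : exists n0 : int, forall (n : int) a,
  n < n0 -> box_count P a (2 ^ n) = 0%N.
Proof.
exists (\big[Num.min/0]_(Q <- P) Q.1) => n a n_lt.
apply/eqP; rewrite -leqn0 leqNgt -has_count; apply/hasPn => Q QP.
rewrite gauge_center_le negb_and -!ltNge; apply/orP; right.
have nQ : n <= Q.1.
  by rewrite (le_trans (ltW n_lt))// ge_bigmin_seq.
have : 2 ^ n <= side Q by rewrite ler_eXz2l ?ltr1n.
by have := side_gt0 Q; lra.
Qed.

Lemma exists_heavy_box P (del : K) : 0 < del <= 1 -> (0 < size P)%N ->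
  exists (n : int) a, del * (size P)%:R <= (box_count P a (2 ^ n))%:R /\
    forall b, (box_count P b (2 ^ n / 2))%:R < del * (size P)%:R.
Proof.
move=> /andP[del_gt0 del_le1] P_gt0.
pose heavy :=
  [set n : int | exists a, del * (size P)%:R <= (box_count P a (2 ^ n))%:R].
have [n0 n0P] := box_count_eq0 P.
have heavy_n0 : lbound heavy n0.
  move=> n [a]; apply: contraLR; rewrite -!ltNge => /n0P ->.
  by rewrite mulr_gt0// ltr0n.
have [n1 n1P] := box_count_eq_size P.
have heavy_n1 : heavy n1 by exists 0; rewrite n1P ler_piMl.
have [n [[a aP] n_min]] := int_lbound_has_minimum (ex_intro _ _ heavy_n1) heavy_n0.
exists n, a; split=> // b; rewrite ltNge; apply/negP => bP.
suff /n_min : heavy (n - 1) by rewrite lerDl.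
by exists b; rewrite expfzDr.
Qed.

Definition subbox_base a (s : K) (t : {ffun 'I_m -> 'I_4}) : 'rV[K]_m :=
  a + \row_i (s * ((t i : nat)%:R - 3 / 2)).

Lemma exists_subbox a (s : K) p : 0 < s -> 0 <= p.2 <= s / 2 ->
  gauge a p <= 2 * s -> exists t, gauge (subbox_base a s t) p <= s / 2.
Proof.
move=> s_gt0 /andP[p2_ge0 p2_le]; rewrite gauge_le// => /andP[p1_le _].
have /choice[t tP] : forall i, exists u : 'I_4,
    `|(p.1 - a) 0 i / s + 2 - (u : nat)%:R - 1 / 2| <= 1 / 2.
  move=> i; apply: exists_unit_interval.
  have := le_trans (coord_le_rV_norm _ i) p1_le; rewrite ler_norml => /andP[? ?].
  have : -2 <= (p.1 - a) 0 i / s <= 2.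
    by rewrite ler_pdivlMr// ler_pdivrMr//; apply/andP; split; lra.
  by move=> /andP[? ?]; apply/andP; split; lra.
exists [ffun i => t i]; rewrite gauge_le// p2_le andbT.
apply/rV_norm_le => [|i]; first by lra.
have -> : (p.1 - subbox_base a s [ffun i => t i]) 0 i =
    s * ((p.1 - a) 0 i / s + 2 - (t i : nat)%:R - 1 / 2).
  by rewrite !mxE ffunE; field; rewrite gt_eqF.
by rewrite normrM gtr0_norm// ler_pM2l// (le_trans (tP i))// mul1r.
Qed.

Lemma count_large_cells_le P (n : int) a : uniq P ->
  (count (fun Q => ((Q.1 == n - 1) || (Q.1 == n)) &&
                   (`|(center Q).1 - a| <= 2 * 2 ^ n))%R P
    <= 2 * (8 * m + 9) ^ m)%N.
Proof.
move=> uP; pose level l Q := (Q.1 == l) && (`|(center Q).1 - a| <= 2 * 2 ^ n).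
have level_le l : n - 1 <= l -> (count (level l) P <= (8 * m + 9) ^ m)%N.
  move=> nl; apply: count_level_le => //.
  have n_gt0 : 0 < (2 : K) ^ n by rewrite exprz_gt0.
  have nl_exp : 2 ^ n / 2 <= (2 : K) ^ l.
    by rewrite -(expfzDr n (-1))// ler_eXz2l// ltr1n.
  apply: (lt_le_trans (_ : _ < (8 * m + 9)%:R * (2 ^ n / 2))).
    by rewrite natrD natrM -[m.+1%:R]natr1; nra.
  by rewrite ler_wpM2l.
rewrite mul2n -addnn; apply: leq_trans (leq_add (level_le (n - 1) _) (level_le n _)).
- rewrite -count_predUI (leq_trans _ (leq_addr _ _))//; apply: sub_count => Q /=.
  by rewrite /level -andb_orl.
- by [].
- by rewrite gerBl.
Qed.

Lemma box_count_double P (n : int) a (B : K) : uniq P ->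
  (forall b, (box_count P b (2 ^ n / 2))%:R <= B) ->
  (box_count P a (2 * 2 ^ n))%:R <= 2 * (8 * m + 9)%:R ^+ m + 4 ^+ m * B.
Proof.
move=> uP BP; set s := (2 : K) ^ n; have s_gt0 : 0 < s by rewrite exprz_gt0.
have : (box_count P a (2 * s) <= 2 * (8 * m + 9) ^ m +
    \sum_t box_count P (subbox_base a s t) (s / 2))%N.
  apply: leq_trans (leq_add (count_large_cells_le n a uP) (leqnn _)).
  apply: count_le_cover => Q Qa.
  have := Qa; rewrite gauge_center_le => /andP[Q1a Q2].
  have [small|large] := leP (3 / 2 * side Q) (s / 2).
    apply/orP; right; apply/existsP; apply: exists_subbox => //.
    by rewrite ltW ?center2_gt0.
  apply/orP; left; rewrite Q1a andbT.
  have gt_level : n - 2 < Q.1.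
    by rewrite -(@ltr_eXz2l K 2) ?ltr1n// expfzDr// -exprnN -/(side Q) -/s; lra.
  have lt_level : Q.1 < n + 1.
    by rewrite -(@ltr_eXz2l K 2) ?ltr1n// expfzDr// -/(side Q) -/s; lra.
  by clear -gt_level lt_level; move: (Q.1) gt_level lt_level; lia.
rewrite -(ler_nat K) natrD natrM natrX => /le_trans; apply; rewrite lerD2l natr_sum.
apply: (le_trans (ler_sum _ (fun t _ => BP (subbox_base a s t)))).
by rewrite sumr_const card_ffun !card_ord -[leLHS]mulr_natl natrX.
Qed.

Definition inside a (r : K) Q : bool := gauge a (center Q) + side Q / 2 < r.

Definition outside a (r : K) Q : bool := r < gauge a (center Q) - side Q / 2.

(* Cells reaching the box of size [2 * 2 ^ n] have side at most [2 * 2 ^ n]; the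
   layer of those of side [2 * 2 ^ n / 2 ^ i] is counted by volume. *)
Definition layer (n : int) a (i : nat) Q : bool :=
  (Q.1 == n + 1 - i%:Z) && (`|(center Q).1 - a| <= 3 * 2 ^ n).

Lemma side_layer (n : int) (i : nat) :
  (2 : K) ^ (n + 1 - i%:Z) = 2 * 2 ^ n / 2 ^+ i.
Proof. by rewrite !expfzDr// -exprnN expr1z [2 ^ n * 2]mulrC. Qed.

Lemma count_layer_le P (n : int) a (i : nat) : uniq P ->
  (count (layer n a i) P)%:R / 2 ^+ i <=
    (3 * m + 4)%:R ^+ m * (2 ^+ m / 2) ^+ i :> K.
Proof.
move=> uP; have i_gt0 : 0 < (2 : K) ^+ i by rewrite exprn_gt0.
have : (count (layer n a i) P <= ((3 * m + 4) * 2 ^ i) ^ m)%N.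
  apply: count_level_le => //.
  rewrite side_layer natrM natrX natrD natrM -[m.+1%:R]natr1.
  have n_gt0 : 0 < (2 : K) ^ n by rewrite exprz_gt0.
  rewrite [ltRHS](_ : _ = (3 * m%:R + 4) * (2 * 2 ^ n)); first by nra.
  by field; rewrite gt_eqF.
rewrite -(ler_nat K) natrX natrM exprMn natrX ler_pdivrMr// => /le_trans; apply.
rewrite -mulrA ler_wpM2l ?exprn_ge0// expr_div_n mulfVK ?gt_eqF//.
by rewrite -!exprM mulnC.
Qed.

Lemma side_le_layers (n : int) a (I : nat) Q :
  ~~ outside a (2 * 2 ^ n) Q -> side Q / 2 ^ n <=
  2 * (\sum_(i < I.+1) (layer n a i Q)%:R / 2 ^+ i + 1 / 2 ^+ I).
Proof.
rewrite -leNgt; set s := (2 : K) ^ n => Q_reaches.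
have s_gt0 : 0 < s by rewrite exprz_gt0.
have Q_low : side Q <= 2 * s by have := le_gauge_center a Q; lra.
have : gauge a (center Q) <= 3 * s by lra.
rewrite gauge_center_le => /andP[Q_near _].
have level_le : Q.1 <= n + 1.
  by rewrite -(@ler_eXz2l K 2) ?ltr1n// expfzDr// expr1z -/(side Q) mulrC.
pose k := `|(n + 1 - Q.1)%R|%N; have Qk : Q.1 = n + 1 - k%:Z by rewrite /k; lia.
have exp_gt0 i : 0 < (2 : K) ^+ i by rewrite exprn_gt0.
have term_ge0 i : 0 <= (layer n a i Q)%:R / (2 : K) ^+ i by rewrite divr_ge0// ltW.
have -> : side Q / s = 2 * (1 / 2 ^+ k).
  by rewrite /side Qk side_layer -/s; field; rewrite !gt_eqF.
rewrite ler_pM2l//; have [kI|Ik] := ltnP k I.+1.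
  rewrite (bigD1 (Ordinal kI))//= {1}/layer Qk eqxx Q_near -addrA lerDl.
  by rewrite addr_ge0 ?sumr_ge0// divr_ge0// ltW.
apply: le_trans (_ : 1 / 2 ^+ I <= _); last by rewrite lerDr sumr_ge0.
by rewrite ler_pM2l// lef_pV2 ?posrE// ler_eXn2l ?ltr1n// ltnW.
Qed.

Lemma sum_side_le P (n : int) a (I : nat) : uniq P ->
  \sum_(Q <- P | ~~ outside a (2 * 2 ^ n) Q) side Q / 2 ^ n <=
  2 * ((3 * m + 4)%:R ^+ m * (\sum_(i < I.+1) (2 ^+ m / 2) ^+ i) +
       (size P)%:R / 2 ^+ I).
Proof.
move=> uP; rewrite big_mkcond /=.
apply: (@le_trans _ _ (\sum_(Q <- P)
    2 * (\sum_(i < I.+1) (layer n a i Q)%:R / 2 ^+ i + 1 / 2 ^+ I))).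
  apply: ler_sum => Q _; case: ifPn => [|_]; first exact: side_le_layers.
  by rewrite mulr_ge0// addr_ge0 ?sumr_ge0// => *; rewrite divr_ge0 ?exprn_ge0.
rewrite -mulr_sumr ler_pM2l// big_split /= lerD//; last first.
  by rewrite big_const_seq count_predT iter_addr_0 -[leLHS]mulr_natl mul1r.
rewrite exchange_big /= mulr_sumr; apply: ler_sum => i _.
by rewrite -mulr_suml -natr_count count_layer_le.
Qed.

Definition hits a (r1 r2 : K) Q : bool := ~~ inside a r1 Q && ~~ outside a r2 Q.

Lemma sum_hits_le a (s eta : K) (N : nat) Q : 0 < eta ->
  \sum_(j < N) (hits a (s + eta * (j : nat)%:R) (s + eta * j.+1%:R) Q)%:R <=
  side Q / eta + 2.
Proof.
move=> eta_gt0; pose w := side Q / eta + 1.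
have w_ge0 : 0 <= w by rewrite addr_ge0// divr_ge0// ltW// side_gt0.
have -> : side Q / eta + 2 = w + 1 by rewrite /w; ring.
pose j0 := (gauge a (center Q) - side Q / 2 - s) / eta - 1.
apply: le_trans (card_ord_window_le N j0 w_ge0).
rewrite -natr_sum ler_nat -sum1_card [leqRHS]big_mkcond /=.
apply: leq_sum => j _; rewrite /hits /inside /outside inE -!leNgt.
case: andP => // -[r1_le r2_ge]; rewrite ifT//.
rewrite /j0 lerBlDr ler_pdivrMr//.
rewrite [X in _ && (_ <= X)](_ : _ = (gauge a (center Q) + side Q / 2 - s) / eta).
  rewrite -[j.+1%:R]natr1 in r2_ge.
  by rewrite ler_pdivlMr//; apply/andP; split; lra.
by rewrite /w; field; rewrite gt_eqF.
Qed.

(* Average over [size P] parallel shells between the box and its double. *)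
Lemma exists_light_shell P (n : int) a : (0 < size P)%N ->
  exists r1 r2 : K, [/\ r1 < r2, 2 ^ n <= r1, r2 <= 2 * 2 ^ n &
    (count (hits a r1 r2) P)%:R <= 2 +
      \sum_(Q <- P | ~~ outside a (2 * 2 ^ n) Q) side Q / 2 ^ n].
Proof.
move=> P_gt0; set s := (2 : K) ^ n; have s_gt0 : 0 < s by rewrite exprz_gt0.
set S := \sum_(_ <- _ | _) _; pose N := size P; pose eta := s / N%:R.
have N_gt0 : 0 < N%:R :> K by rewrite ltr0n.
have eta_gt0 : 0 < eta by rewrite divr_gt0.
have etaN : eta * N%:R = s by rewrite mulfVK ?gt_eqF.
pose r (j : nat) := s + eta * j%:R.
have r_ge j : s <= r j by rewrite lerDl mulr_ge0// ltW.
have r_le (j : 'I_N) : r j.+1 <= 2 * s.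
  by rewrite mulr2n mulrDl mul1r lerD2l -etaN ler_pM2l// ler_nat.
have [j jP] : exists j : 'I_N, (count (hits a (r j) (r j.+1)) P)%:R <= 2 + S.
  apply: exists_le_mean; rewrite card_ord//.
  under eq_bigr do rewrite natr_count.
  rewrite exchange_big /=.
  have -> : N%:R * (2 + S) = \sum_(Q <- P) 2 +
      \sum_(Q <- P | ~~ outside a (2 * s) Q) side Q / eta.
    rewrite big_const_seq count_predT iter_addr_0 -[X in _ = X + _]mulr_natl -/N.
    rewrite mulrDr; congr (_ + _); rewrite /S mulr_sumr; apply: eq_bigr => Q _.
    by rewrite -/s -etaN; field; rewrite !gt_eqF.
  rewrite [X in _ + X]big_mkcond -big_split /=; apply: ler_sum => Q _.
  case: ifPn => [_|]; first by rewrite addrC sum_hits_le.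
  rewrite negbK => Q_out; rewrite big1 ?addr0// => j _.
  by rewrite /hits /outside (le_lt_trans (r_le j) Q_out) andbF.
exists (r j), (r j.+1); split=> //.
by rewrite ltrD2l ltr_pM2l// ltr_nat.
Qed.

Definition heavy_ratio : K := (4 ^+ m.+1)^-1.

Lemma heavy_ratio_itv : 0 < heavy_ratio <= 1 / 4.
Proof.
rewrite invr_gt0 exprn_gt0//= mul1r lef_pV2 ?posrE ?exprn_gt0//.
by rewrite exprS ler_peMr// exprn_ege1// ler1n.
Qed.

Lemma exp4_heavy_ratio : 4 ^+ m * heavy_ratio = 1 / 4.
Proof. by rewrite /heavy_ratio exprS; field; rewrite expf_neq0. Qed.

Definition shrink : K := 1 - heavy_ratio.

Lemma shrink_itv : 0 <= shrink < 1.
Proof.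
by have /andP[? ?] := heavy_ratio_itv; rewrite /shrink; apply/andP; split; lra.
Qed.

Definition small_size : nat := 4 * (8 * m + 9) ^ m.

Lemma count_inside_le P (n : int) a (r : K) : uniq P ->
  (small_size <= size P)%N -> r <= 2 * 2 ^ n ->
  (forall b, (box_count P b (2 ^ n / 2))%:R <= heavy_ratio * (size P)%:R) ->
  (count (inside a r) P)%:R <= shrink * (size P)%:R.
Proof.
move=> uP; rewrite -(ler_nat K) natrM natrX => P_large r_le /(box_count_double a uP).
rewrite mulrA exp4_heavy_ratio => double_le.
have : (count (inside a r) P)%:R <= (box_count P a (2 * 2 ^ n))%:R :> K.
  rewrite ler_nat; apply: sub_count => Q; rewrite /inside => Q_in.
  by have := side_gt0 Q; lra.
have : 3 / 4 * (size P)%:R <= shrink * (size P)%:R.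
  by rewrite ler_wpM2r// /shrink; have /andP[] := heavy_ratio_itv; lra.
by lra.
Qed.

Lemma count_outside_le P (n : int) a (r : K) : 2 ^ n <= r ->
  heavy_ratio * (size P)%:R <= (box_count P a (2 ^ n))%:R ->
  (count (outside a r) P)%:R <= shrink * (size P)%:R.
Proof.
move=> r_ge heavy.
have : (count (outside a r) P + box_count P a (2 ^ n) <= size P)%N.
  rewrite -(count_predC (fun Q => gauge a (center Q) <= 2 ^ n)) addnC leq_add2l.
  apply: sub_count => Q /=; rewrite /outside -ltNge => Q_out.
  by have := side_gt0 Q; lra.
by rewrite -(ler_nat K) natrD /shrink; lra.
Qed.

(* Layers [0] to [I] are counted by volume, the cells beyond them all at once. *)
Definition separator_cost (I N : nat) : K :=
  \sum_(i < I.+1) (2 ^+ m / 2) ^+ i + N%:R / 2 ^+ I + 1.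

Definition separator_factor : K := 2 * (3 * m + 4)%:R ^+ m.

Lemma exists_separator P (I : nat) : uniq P -> (small_size <= size P)%N ->
  exists a (r1 r2 : K), [/\ r1 < r2,
    (count (hits a r1 r2) P)%:R <= separator_factor * separator_cost I (size P),
    (count (inside a r1) P)%:R <= shrink * (size P)%:R &
    (count (outside a r2) P)%:R <= shrink * (size P)%:R].
Proof.
move=> uP P_large; have /andP[ratio_gt0 ratio_le] := heavy_ratio_itv.
have P_gt0 : (0 < size P)%N.
  by apply: leq_trans P_large; rewrite muln_gt0 expn_gt0 addnS.
have ratio_itv : 0 < heavy_ratio <= 1 by apply/andP; split; lra.
have [n [a [heavy light]]] := exists_heavy_box ratio_itv P_gt0.
have [r1 [r2 [r12 r1_ge r2_le light_shell]]] := exists_light_shell n a P_gt0.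
exists a, r1, r2; split=> //; last by apply: count_outside_le heavy; lra.
- apply: (le_trans light_shell).
  apply: (le_trans (lerD (lexx _) (sum_side_le n a I uP))).
  rewrite /separator_cost /separator_factor.
  set k := _ ^+ m; set X := \sum_(i < _) _; set Y := _ / _.
  have k_ge1 : 1 <= k by rewrite exprn_ege1// ler1n addnS.
  have Y_ge0 : 0 <= Y by rewrite divr_ge0// exprn_ge0.
  by nra.
- by apply: (count_inside_le a uP P_large _ (fun b => ltW (light b))); lra.
Qed.

(** * Sweeping a set of cells *)

Definition crosses (h : point -> K) (c : K) Q : bool := c \in h @` region Q.

Definition sweepable P (B : K) : Prop :=
  exists h : point -> K, [/\ continuous h, forall p, 0 <= h p <= 1 &
    forall c, (count (crosses h c) P)%:R <= B].

Lemma sweepable_le P (B B' : K) : B <= B' -> sweepable P B -> sweepable P B'.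
Proof.
move=> BB' [h [h_cont h_itv h_le]]; exists h; split=> // c.
exact: le_trans (h_le c) BB'.
Qed.

Lemma sweepable_size P : sweepable P (size P)%:R.
Proof.
exists (fun=> 0); split=> [p|p|c]; first exact: cvg_cst.
  by rewrite lexx ler01.
by rewrite ler_nat count_size.
Qed.

Definition ramp (r1 r2 t : K) : K := Num.max 0 (Num.min 1 ((t - r1) / (r2 - r1))).

Lemma ramp_itv (r1 r2 t : K) : 0 <= ramp r1 r2 t <= 1.
Proof. by rewrite /ramp le_max lexx /= ge_max ler01 ge_min lexx. Qed.

Lemma ramp_low (r1 r2 t : K) : r1 < r2 -> t <= r1 -> ramp r1 r2 t = 0.
Proof.
move=> r12 tr; apply/max_idPl; rewrite ge_min ler_pdivrMr ?subr_gt0//.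
by rewrite mul0r subr_le0 tr orbT.
Qed.

Lemma ramp_high (r1 r2 t : K) : r1 < r2 -> r2 <= t -> ramp r1 r2 t = 1.
Proof.
move=> r12 tr; rewrite /ramp; have /min_idPl -> : 1 <= (t - r1) / (r2 - r1).
  by rewrite ler_pdivlMr ?subr_gt0// mul1r lerD2r.
by apply/max_idPr.
Qed.

Lemma ramp_continuous (r1 r2 : K) : continuous (ramp r1 r2).
Proof.
move=> t; have slope_cont : {for t, continuous (fun u => (u - r1) / (r2 - r1))}.
  by apply: cvgM; [apply: cvgB; [exact: cvg_id|exact: cvg_cst]|exact: cvg_cst].
by apply: continuous_max (continuous_min _ slope_cont); exact: cvg_cst.
Qed.

Lemma gauge_continuous a : continuous (gauge a).
Proof.
by move=> p; apply: cvg_norm; apply: cvgB; [exact: cvg_id|exact: cvg_cst].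
Qed.

(* [h1 / 3] inside and [(h2 + 2) / 3] outside have disjoint ranges, so a level set
   of [glue] leaves the shell on one side only. *)
Definition glue a (r1 r2 : K) (h1 h2 : point -> K) p : K :=
  (h1 p + ramp r1 r2 (gauge a p) * (h2 p + 2 - h1 p)) / 3.

Section glue.
Context (a : 'rV[K]_m) (r1 r2 : K) (h1 h2 : point -> K).
Hypotheses (r12 : r1 < r2) (h1_itv : forall p, 0 <= h1 p <= 1)
  (h2_itv : forall p, 0 <= h2 p <= 1).
Local Notation glued := (glue a r1 r2 h1 h2).

Lemma glue_itv p : 0 <= glued p <= 1.
Proof.
have /andP[? ?] := h1_itv p; have /andP[? ?] := h2_itv p.
have /andP[? ?] := ramp_itv r1 r2 (gauge a p).
by rewrite /glue; apply/andP; split; nra.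
Qed.

Lemma glue_continuous : continuous h1 -> continuous h2 -> continuous glued.
Proof.
move=> h1_cont h2_cont p.
have ramp_cont : (ramp r1 r2 \o gauge a) @ p --> ramp r1 r2 (gauge a p).
  by apply: continuous_comp; [exact: gauge_continuous|exact: ramp_continuous].
apply: cvgM; last exact: cvg_cst; apply: cvgD; first exact: h1_cont.
apply: cvgM => //; apply: cvgB; last exact: h1_cont.
by apply: cvgD; [exact: h2_cont|exact: cvg_cst].
Qed.

Lemma crosses_glue_inside (c : K) Q : inside a r1 Q -> crosses glued c Q ->
  crosses h1 (3 * c) Q /\ c <= 1 / 3.
Proof.
rewrite /inside => Q_in /set_mem[p Qp]; have /andP[_ p_le] := gauge_region a Qp.
have /andP[_ h1_le1] := h1_itv p.
rewrite /glue ramp_low//; last by lra.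
rewrite mul0r addr0 => <-; split; last by lra.
by apply/mem_set; exists p => //; field.
Qed.

Lemma crosses_glue_outside (c : K) Q : outside a r2 Q -> crosses glued c Q ->
  crosses h2 (3 * c - 2) Q /\ 2 / 3 <= c.
Proof.
rewrite /outside => Q_out /set_mem[p Qp]; have /andP[p_ge _] := gauge_region a Qp.
have /andP[h2_ge0 _] := h2_itv p.
rewrite /glue ramp_high//; last by lra.
rewrite mul1r => <-; split; last by lra.
by apply/mem_set; exists p => //; field.
Qed.

Lemma crosses_glue_low (c : K) Q : c <= 1 / 2 -> crosses glued c Q ->
  hits a r1 r2 Q || crosses h1 (3 * c) Q && inside a r1 Q.
Proof.
move=> c_le cQ; rewrite /hits; case: (boolP (inside a r1 Q)) => Q_in /=.
  by have [-> _] := crosses_glue_inside Q_in cQ.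
case: (boolP (outside a r2 Q)) => //= Q_out.
by have [_] := crosses_glue_outside Q_out cQ; lra.
Qed.

Lemma crosses_glue_high (c : K) Q : 1 / 2 <= c -> crosses glued c Q ->
  hits a r1 r2 Q || crosses h2 (3 * c - 2) Q && outside a r2 Q.
Proof.
move=> c_ge cQ; rewrite /hits; case: (boolP (outside a r2 Q)) => Q_out /=.
  by have [-> _] := crosses_glue_outside Q_out cQ; rewrite orbT.
case: (boolP (inside a r1 Q)) => //= Q_in.
by have [_] := crosses_glue_inside Q_in cQ; lra.
Qed.

End glue.

Lemma sweepable_glue P a (r1 r2 B : K) : r1 < r2 ->
  sweepable [seq Q <- P | inside a r1 Q] B ->
  sweepable [seq Q <- P | outside a r2 Q] B ->
  sweepable P ((count (hits a r1 r2) P)%:R + B).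
Proof.
move=> r12 [h1 [h1_cont h1_itv h1_le]] [h2 [h2_cont h2_itv h2_le]].
exists (glue a r1 r2 h1 h2); split=> [|p|c]; first exact: glue_continuous.
  exact: glue_itv.
have count_le (p : pred cell) : (count p P)%:R <= B ->
    (forall Q, crosses (glue a r1 r2 h1 h2) c Q -> hits a r1 r2 Q || p Q) ->
    (count (crosses (glue a r1 r2 h1 h2) c) P)%:R <= (count (hits a r1 r2) P)%:R + B.
  move=> p_le crossP; apply: le_trans (lerD (lexx _) p_le).
  rewrite -natrD ler_nat -count_predUI (leq_trans _ (leq_addr _ _))//.
  exact: sub_count.
have [c_le|/ltW c_ge] := leP c (1 / 2).
- have := h1_le (3 * c); rewrite count_filter => /count_le; apply => Q.
  exact: crosses_glue_low.
- have := h2_le (3 * c - 2); rewrite count_filter => /count_le; apply => Q.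
  exact: crosses_glue_high.
Qed.

(* Only one side of the separator is charged, as a level set of [glue] visits a
   single side of the shell. *)
Definition absorbs_separators (F : nat -> K) : Prop :=
  forall N, (0 < N)%N -> exists I, forall n, n%:R <= shrink * N%:R ->
    F n + separator_factor * separator_cost I N <= F N.

Theorem absorbs_separators_sweepable (F : nat -> K) P : (forall n, 0 <= F n) ->
  absorbs_separators F -> uniq P -> sweepable P (F (size P) + small_size%:R).
Proof.
move=> F_ge0 F_absorb; have [n] := ubnP (size P); elim: n P => // n IH P lt_n uP.
have [small|large] := leqP (size P) small_size.
  by apply: sweepable_le (sweepable_size P); rewrite ler_wpDl// ler_nat.
have P_gt0 : (0 < size P)%N by apply: leq_ltn_trans large.
have [I F_step] := F_absorb _ P_gt0.
have [a [r1 [r2 [r12 hits_le in_le out_le]]]] := exists_separator I uP (ltnW large).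
pose B := F (size P) - separator_factor * separator_cost I (size P) + small_size%:R.
have side_sweepable (p : pred cell) : (count p P)%:R <= shrink * (size P)%:R ->
    sweepable [seq Q <- P | p Q] B.
  move=> p_le; have lt_size : (size [seq Q <- P | p Q] < size P)%N.
    have /andP[_ shrink_lt1] := shrink_itv.
    by rewrite size_filter -(ltr_nat K) (le_lt_trans p_le)// gtr_pMl ?ltr0n.
  apply: sweepable_le (IH _ (leq_trans lt_size _) (filter_uniq _ uP)) => //.
  by rewrite lerD2r lerBrDr F_step// size_filter.
have := sweepable_glue r12 (side_sweepable _ in_le) (side_sweepable _ out_le).
apply: sweepable_le.
by rewrite /B; lra.
Qed.

End half_space_cells.

(** * Solving the recursion *)

Section growth.
Context (K : realType).

Lemma trunc_log_itv (b N : nat) : (1 < b)%N -> (0 < N)%N ->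
  b%:R ^+ trunc_log b N <= (N%:R : K) < b%:R ^+ (trunc_log b N).+1.
Proof.
by move=> b_gt1 N_gt0; rewrite -!natrX ler_nat ltr_nat trunc_logP// trunc_log_ltn.
Qed.

Lemma absorbs_separators_scale (m : nat) (F S : nat -> K) (C gap : K) :
  0 <= C -> 0 < gap ->
  (forall N, (0 < N)%N -> exists I, separator_cost K m I N <= C * S N) ->
  (forall n N, (0 < N)%N -> n%:R <= shrink K m * N%:R -> F n + gap * S N <= F N) ->
  exists2 A, 0 <= A & absorbs_separators m (fun N => A * F N).
Proof.
move=> C_ge0 gap_gt0 costP gapP.
have factor_ge0 : 0 <= separator_factor K m by rewrite mulr_ge0// exprn_ge0.
have A_ge0 : 0 <= separator_factor K m * C / gap.
  by rewrite divr_ge0 ?mulr_ge0// ltW.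
exists (separator_factor K m * C / gap) => // N N_gt0.
have [I cost_le] := costP N N_gt0; exists I => n n_le.
apply: le_trans (ler_wpM2l A_ge0 (gapP n N N_gt0 n_le)).
rewrite [leRHS]mulrDr lerD2l.
have -> : separator_factor K m * C / gap * (gap * S N) =
    separator_factor K m * (C * S N) by field; rewrite gt_eqF.
exact: ler_wpM2l.
Qed.

Lemma separator_cost_power (m : nat) : (1 < m)%N ->
  exists2 C : K, 0 <= C & forall N, (0 < N)%N ->
    exists I, separator_cost K m I N <= C * N%:R `^ (1 - m%:R^-1).
Proof.
move=> m_gt1; pose q : K := 2 ^+ m; exists (3 + q).
  by rewrite addr_ge0 ?exprn_ge0.
move=> N N_gt0; pose I := trunc_log (2 ^ m) N; exists I.
have q_natE : (2 ^ m)%:R = q by rewrite natrX.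
have q_gt0 : 0 < q by rewrite exprn_gt0.
have base_gt1 : (1 < 2 ^ m)%N by rewrite -[ltnLHS](expn0 2) ltn_exp2l//; lia.
have /andP[] := trunc_log_itv base_gt1 N_gt0; rewrite -/I q_natE => qI_le N_lt.
have half_q_ge2 : 2 <= q / 2.
  by rewrite ler_pdivlMr// -[2 * 2]expr2 ler_eXn2l// ltr1n.
have m_neq0 : m%:R != 0 :> K by rewrite pnatr_eq0; lia.
have al_ge0 : 0 <= 1 - m%:R^-1 :> K.
  by rewrite subr_ge0 invf_le1 ?ltr0n ?ler1n; lia.
have qI_power : (q / 2) ^+ I <= N%:R `^ (1 - m%:R^-1).
  apply: le_trans (ge0_ler_powR al_ge0 _ _ qI_le);
    rewrite ?nnegrE ?exprn_ge0 ?(ltW q_gt0)//.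
  have pow2_root : (q ^+ I) `^ m%:R^-1 = 2 ^+ I.
    rewrite -exprM mulnC exprM -powR_mulrn ?exprn_ge0// -powRrM mulfV//.
    by rewrite powRr1 ?exprn_ge0.
  rewrite powRB; last by apply/implyP => _; rewrite expf_neq0// gt_eqF.
  by rewrite powRr1 ?exprn_ge0 ?(ltW q_gt0)// pow2_root expr_div_n.
have N_div : N%:R / 2 ^+ I <= q * (q / 2) ^+ I.
  rewrite expr_div_n mulrA -exprS ler_pM2r ?invr_gt0 ?exprn_gt0//.
  exact: ltW.
have power_ge1 : 1 <= (q / 2) ^+ I.
  by rewrite exprn_ege1// (le_trans _ half_q_ge2)// ler1n.
apply: (@le_trans _ _ ((3 + q) * (q / 2) ^+ I)).
  by have := geometric_sum_le I half_q_ge2; rewrite /separator_cost -/q; lra.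
by rewrite ler_wpM2l// addr_ge0// ltW.
Qed.

Lemma power_gap (m : nat) (al : K) : 0 < al -> exists2 gap : K, 0 < gap &
  forall n N : nat, n%:R <= shrink K m * N%:R ->
    n%:R `^ al + gap * N%:R `^ al <= N%:R `^ al.
Proof.
move=> al_gt0; have /andP[shrink_ge0 shrink_lt1] := shrink_itv K m.
exists (1 - shrink K m `^ al).
  have := gt0_ltr_powR al_gt0 shrink_ge0 ler01 shrink_lt1.
  by rewrite powR1 subr_gt0.
move=> n N n_le.
have : n%:R `^ al <= (shrink K m * N%:R) `^ al.
  by apply: ge0_ler_powR; rewrite ?nnegrE ?(ltW al_gt0)// mulr_ge0.
by rewrite powRM//; lra.
Qed.

Lemma absorbs_separators_power (m : nat) : (1 < m)%N -> exists2 A : K, 0 <= A &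
  absorbs_separators m (fun N => A * N%:R `^ (1 - m%:R^-1)).
Proof.
move=> m_gt1; have [C C_ge0 costP] := separator_cost_power m_gt1.
have al_gt0 : 0 < 1 - m%:R^-1 :> K.
  by rewrite subr_gt0 invf_lt1 ?ltr1n ?ltr0n; lia.
have [gap gap_gt0 gapP] := power_gap m al_gt0.
exact: absorbs_separators_scale C_ge0 gap_gt0 costP (fun n N _ => gapP n N).
Qed.

Lemma separator_cost_log : exists2 C : K, 0 <= C & forall N, (0 < N)%N ->
  exists I, separator_cost K 1 I N <= C * ln (1 + N%:R).
Proof.
have ln2_gt0 : 0 < ln (2 : K) by rewrite ln_gt0// ltr1n.
exists (5 / ln 2); first by rewrite divr_ge0// ltW.
move=> N N_gt0; pose I := trunc_log 2 N; exists I.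
have /andP[] := trunc_log_itv (isT : (1 < 2)%N) N_gt0; rewrite -/I => I_le N_lt.
have -> : separator_cost K 1 I N = I%:R + N%:R / 2 ^+ I + 2.
  rewrite /separator_cost; under eq_bigr do rewrite divff// expr1n.
  by rewrite sumr_const card_ord -natr1; ring.
have I_gt0 : 0 < (2 : K) ^+ I by rewrite exprn_gt0.
have N_div : N%:R / 2 ^+ I <= 2 :> K by rewrite ler_pdivrMr// -exprS ltW.
have N_ge1 : 1 <= N%:R :> K by rewrite ler1n.
have ln2_le : ln 2 <= ln (1 + N%:R : K) by rewrite ler_ln ?posrE//; lra.
have I_ln : I%:R * ln 2 <= ln (1 + N%:R : K).
  by rewrite mulr_natl -lnXn// ler_ln ?posrE//; lra.
apply: (@le_trans _ _ (I%:R + 4)); first by lra.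
by rewrite mulrAC ler_pdivlMr//; lra.
Qed.

Lemma sqr_log_gap (m : nat) : exists2 gap : K, 0 < gap &
  forall n N : nat, (0 < N)%N -> n%:R <= shrink K m * N%:R ->
    ln (1 + n%:R) ^+ 2 + gap * ln (1 + N%:R) <= ln (1 + N%:R) ^+ 2.
Proof.
have /andP[shrink_ge0 shrink_lt1] := shrink_itv K m.
pose t : K := (1 + shrink K m) / 2; have t_gt0 : 0 < t by rewrite /t; lra.
have log_lt0 : ln t < 0 by rewrite ln_lt0// t_gt0 /t /=; lra.
exists (- ln t); first by rewrite oppr_gt0.
move=> n N N_gt0 n_le; have N_ge1 : 1 <= N%:R :> K by rewrite ler1n.
have n_ge0 : 0 <= n%:R :> K by [].
have [n1_gt0 N1_gt0] : 0 < 1 + n%:R :> K /\ 0 < 1 + N%:R :> K by lra.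
have n_log : ln (1 + n%:R) <= ln (1 + N%:R) + ln t.
  by rewrite -lnM ?ler_ln ?posrE ?mulr_gt0// /t; nra.
have n_log_ge0 : 0 <= ln (1 + n%:R : K) by rewrite ln_ge0//; lra.
by move: log_lt0 n_log n_log_ge0; nra.
Qed.

Lemma absorbs_separators_sqr_log : exists2 A : K, 0 <= A &
  absorbs_separators 1 (fun N => A * ln (1 + N%:R) ^+ 2).
Proof.
have [C C_ge0 costP] := separator_cost_log.
have [gap gap_gt0 gapP] := sqr_log_gap 1.
exact: absorbs_separators_scale C_ge0 gap_gt0 costP gapP.
Qed.

End growth.

(** * The upper half-space chart of the hyperboloid *)

Section half_space_chart.
Context (k : nat).
Implicit Types (p : R * 'rV[R]_k.+1) (u : 'rV[R]_k * R).

Local Notation space p := (rsubmx (p.2 : 'rV[R]_(1 + k))).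

Definition hgt p : R := (p.1 - p.2 0 ord0)^-1.

Definition chart p : 'rV[R]_k * R := (hgt p *: space p, hgt p).

Definition hpoint u : R * 'rV[R]_k.+1 :=
  let w := u.2 + (\sum_i u.1 0 i ^+ 2) / u.2 in
  ((w + u.2^-1) / 2, row_mx ((w - u.2^-1) / 2)%:M (u.2^-1 *: u.1)).

Lemma lor_recl p p' : lor _ p p' =
  p.1 * p'.1 - p.2 0 ord0 * p'.2 0 ord0 -
  \sum_i space p 0 i * space p' 0 i.
Proof.
rewrite /lor big_ord_recl opprD addrA; congr (_ - _).
by apply: eq_bigr => i _; rewrite !mxE !rshift1.
Qed.

Lemma Hyp_lightlike_gt0 p : Hyp k.+1 p -> 0 < p.1 - p.2 0 ord0.
Proof.
move=> [p1_gt0]; rewrite lor_recl.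
have : 0 <= \sum_i space p 0 i * space p 0 i.
  by apply: sumr_ge0 => i _; rewrite -expr2 sqr_ge0.
move: (\sum_i _) (p.1) (p.2 0 ord0) p1_gt0 => S t v t_gt0 S_ge0 lorE.
by have [|//] := lerP (t - v) 0; nra.
Qed.

Lemma hgt_gt0 p : Hyp k.+1 p -> 0 < hgt p.
Proof. by move=> /Hyp_lightlike_gt0; rewrite invr_gt0. Qed.

Lemma lor_chart p p' : Hyp k.+1 p -> Hyp k.+1 p' -> lor _ p p' =
  1 + (\sum_i ((chart p).1 - (chart p').1) 0 i ^+ 2 + (hgt p - hgt p') ^+ 2)
      / (2 * hgt p * hgt p').
Proof.
move=> Hp Hp'; have := Hyp_lightlike_gt0 Hp; have := Hyp_lightlike_gt0 Hp'.
have -> : \sum_i ((chart p).1 - (chart p').1) 0 i ^+ 2 =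
    (\sum_i space p 0 i * space p 0 i) * hgt p ^+ 2 +
    (\sum_i space p' 0 i * space p' 0 i) * hgt p' ^+ 2 -
    (\sum_i space p 0 i * space p' 0 i) * (2 * hgt p * hgt p').
  rewrite !mulr_suml -big_split /= -sumrB; apply: eq_bigr => i _.
  by rewrite /chart /= !mxE; ring.
move: Hp Hp' => [_] + [_]; rewrite !lor_recl /hgt.
set S := \sum_i space p 0 i * space p 0 i.
set S' := \sum_i space p' 0 i * space p' 0 i; set S'' := \sum_i _.
move: (p.1) (p.2 0 ord0) (p'.1) (p'.2 0 ord0) => t v t' v' lorE lorE' tv'_gt0 tv_gt0.
have -> : S = (t - v) * (t + v) - 1 by lra.
have -> : S' = (t' - v') * (t' + v') - 1 by lra.
by field; rewrite !gt_eqF.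
Qed.

Lemma lor_ge1 p p' : Hyp k.+1 p -> Hyp k.+1 p' -> 1 <= lor _ p p'.
Proof.
move=> Hp Hp'; rewrite lor_chart// lerDl divr_ge0//.
  by rewrite addr_ge0 ?sqr_ge0// sumr_ge0// => i _; rewrite sqr_ge0.
by rewrite !mulr_ge0// ltW// hgt_gt0.
Qed.

Lemma hpoint2_0 u :
  (hpoint u).2 0 ord0 = (u.2 + (\sum_i u.1 0 i ^+ 2) / u.2 - u.2^-1) / 2.
Proof.
by rewrite -[ord0](lshift0 k 0); apply: etrans (row_mxEl _ _ _ _) _; rewrite mxE.
Qed.

Lemma hpointK u : 0 < u.2 -> chart (hpoint u) = u.
Proof.
case: u => x y /= y_gt0.
have hgtE : hgt (hpoint (x, y)) = y.
  by rewrite /hgt hpoint2_0 -[RHS]invrK; congr _^-1; rewrite /=; lra.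
by rewrite /chart hgtE row_mxKr scalerA mulfV ?gt_eqF// scale1r.
Qed.

Lemma Hyp_hpoint u : 0 < u.2 -> Hyp k.+1 (hpoint u).
Proof.
move=> u2_gt0.
have S_ge0 : 0 <= \sum_i u.1 0 i ^+ 2 by apply: sumr_ge0 => i _; rewrite sqr_ge0.
split.
  by rewrite divr_gt0// addr_gt0 ?invr_gt0// ltr_wpDr ?divr_ge0 ?(ltW u2_gt0).
have spaceE : \sum_i space (hpoint u) 0 i * space (hpoint u) 0 i =
    (\sum_i u.1 0 i ^+ 2) / u.2 ^+ 2.
  rewrite mulr_suml; apply: eq_bigr => i _; rewrite row_mxKr mxE.
  by field; rewrite gt_eqF.
by rewrite lor_recl spaceE hpoint2_0 /=; field; rewrite gt_eqF.
Qed.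

Lemma hdist_le1 p p' : Hyp k.+1 p -> Hyp k.+1 p' ->
  lor _ p p' <= 5 / 4 -> hdist _ p p' <= 1.
Proof.
move=> Hp Hp' lor_le; have lor_ge := lor_ge1 Hp Hp'.
rewrite /hdist; move: (lor _ p p') lor_ge lor_le => l l_ge1 l_le.
have sqrt_ge0 := sqrtr_ge0 (l ^+ 2 - 1).
have sqrt_le : Num.sqrt (l ^+ 2 - 1) <= 3 / 4.
  by rewrite -(@ger0_norm _ (3 / 4 : R))// -sqrtr_sqr ler_wsqrtr//; nra.
rewrite (_ : l + _ = 1 + (l - 1 + Num.sqrt (l ^+ 2 - 1))); last by ring.
by rewrite (le_trans (le_ln1Dx _))//; lra.
Qed.

Lemma lor_le_expR_hdist p p' : Hyp k.+1 p -> Hyp k.+1 p' ->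
  lor _ p p' <= expR (hdist _ p p').
Proof.
move=> Hp Hp'; have lor_ge := lor_ge1 Hp Hp'.
have sqrt_ge0 := sqrtr_ge0 (lor _ p p' ^+ 2 - 1).
by rewrite lnK ?posrE; lra.
Qed.

Lemma sqr_chart_dist_le_lor p p' : Hyp k.+1 p -> Hyp k.+1 p' ->
  `|chart p - chart p'| ^+ 2 <= 2 * hgt p * hgt p' * (lor _ p p' - 1).
Proof.
move=> Hp Hp'; have hgt_p := hgt_gt0 Hp; have hgt_p' := hgt_gt0 Hp'.
have -> : 2 * hgt p * hgt p' * (lor _ p p' - 1) =
    \sum_i ((chart p).1 - (chart p').1) 0 i ^+ 2 + (hgt p - hgt p') ^+ 2.
  by rewrite lor_chart//; field; rewrite !gt_eqF.
exact: sqr_pair_norm_le_sum.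
Qed.

Lemma hgt_le_lor p p' : Hyp k.+1 p -> Hyp k.+1 p' ->
  hgt p' <= 2 * lor _ p p' * hgt p.
Proof.
move=> Hp Hp'; have hgt_p := hgt_gt0 Hp; have hgt_p' := hgt_gt0 Hp'.
have : (hgt p - hgt p') ^+ 2 <= 2 * hgt p * hgt p' * (lor _ p p' - 1).
  apply: le_trans (sqr_chart_dist_le_lor Hp Hp').
  rewrite -[leLHS]real_normK ?num_real// lerXn2r ?nnegrE//.
  by rewrite [leRHS]prod_normE le_max lexx orbT.
move: (lor _ p p') (hgt p) (hgt p') hgt_p hgt_p' => l y y' y_gt0 y'_gt0 sqr_le.
by rewrite -(ler_pM2l y'_gt0); have := sqr_ge0 y; lra.
Qed.

Lemma sqr_chart_dist_le p p' : Hyp k.+1 p -> Hyp k.+1 p' ->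
  `|chart p - chart p'| ^+ 2 <=
    4 * lor _ p p' * (lor _ p p' - 1) * hgt p ^+ 2.
Proof.
move=> Hp Hp'; have hgt_p := hgt_gt0 Hp; have lor_ge := lor_ge1 Hp Hp'.
apply: (le_trans (sqr_chart_dist_le_lor Hp Hp')).
have := ler_wpM2l (_ : 0 <= 2 * hgt p * (lor _ p p' - 1)) (hgt_le_lor Hp Hp').
rewrite !mulr_ge0 ?subr_ge0 ?(ltW hgt_p)// => /(_ isT).
by lra.
Qed.

Lemma hdist_le1_chart p p' : Hyp k.+1 p -> Hyp k.+1 p' -> hdist _ p p' <= 1 ->
  hgt p <= 8 * hgt p' /\ `|chart p - chart p'| <= 7 * hgt p.
Proof.
move=> Hp Hp' dist_le; have hgt_p := hgt_gt0 Hp; have hgt_p' := hgt_gt0 Hp'.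
have lor_ge := lor_ge1 Hp Hp'.
have lor_le : lor _ p p' <= 4.
  apply: le_trans (lor_le_expR_hdist Hp Hp') (le_trans _ (expR1_le4 R)).
  by rewrite ler_expR.
have lorC : lor _ p' p = lor _ p p'.
  by rewrite /lor mulrC; congr (_ - _); apply: eq_bigr => i _; rewrite mulrC.
split; first by have := hgt_le_lor Hp' Hp; rewrite lorC; nra.
rewrite -(ler_pXn2r (_ : 0 < 2)%N) ?nnegrE ?mulr_ge0 ?(ltW hgt_p)//.
apply: (le_trans (sqr_chart_dist_le Hp Hp')).
rewrite exprMn ler_wpM2r ?sqr_ge0//.
by nra.
Qed.

Lemma hdist_chart_continuous p (e : R) : Hyp k.+1 p -> 0 < e ->
  exists2 del : R, 0 < del & forall p', Hyp k.+1 p' ->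
    hdist _ p p' < del -> `|chart p - chart p'| < e.
Proof.
move=> Hp e_gt0; have hgt_p := hgt_gt0 Hp.
pose t := Num.min 1 (e ^+ 2 / (16 * hgt p ^+ 2)).
have t_gt0 : 0 < t by rewrite lt_min ltr01 divr_gt0// mulr_gt0// exprn_gt0.
have t_le1 : t <= 1 by rewrite ge_min lexx.
have t_le : 16 * hgt p ^+ 2 * t <= e ^+ 2.
  rewrite -ler_pdivlMl ?mulr_gt0 ?exprn_gt0// mulrC.
  by rewrite ge_min lexx orbT.
exists (ln (1 + t)); first by rewrite ln_gt0// ltrDl.
move=> p' Hp' dist_lt; have lor_ge := lor_ge1 Hp Hp'.
have lor_lt : lor _ p p' < 1 + t.
  apply: (le_lt_trans (lor_le_expR_hdist Hp Hp')).
  by rewrite -ltr_expR lnK// posrE addr_gt0 in dist_lt.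
rewrite -(ltr_pXn2r (_ : 0 < 2)%N) ?nnegrE ?(ltW e_gt0)//.
apply: (le_lt_trans (sqr_chart_dist_le Hp Hp')).
have hgt2_gt0 : 0 < hgt p ^+ 2 by rewrite exprn_gt0.
apply: lt_le_trans t_le; rewrite [ltRHS]mulrAC ltr_pM2r//.
by nra.
Qed.

End half_space_chart.

(** * Maps with small fibres *)

Lemma rV_continuous (K : realFieldType) (T : topologicalType) (n : nat)
    (F : T -> 'rV[K]_n) :
  (forall i, continuous (fun x => F x 0 i)) -> continuous F.
Proof.
move=> F_cont x; apply/cvgrPdist_le => e e_gt0.
have near_coord : \forall y \near x, forall i, `|F x 0 i - F y 0 i| <= e.
  by apply: filter_forall => i; move/cvgrPdist_le : (F_cont i x); apply.
apply: filterS near_coord => y F_le; apply/rV_norm_le => [|i]; first exact: ltW.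
by rewrite !mxE.
Qed.

Lemma continuous_at_norm (K : numFieldType) (V W : pseudoMetricNormedZmodType K)
    (F : V -> W) (x : V) (e : K) : {for x, continuous F} -> 0 < e ->
  exists2 del : K, 0 < del & forall y, `|x - y| < del -> `|F x - F y| <= e.
Proof.
move=> F_cont e_gt0.
have /nbhs_normP[del /= del_gt0 F_le] : \forall y \near x, `|F x - F y| <= e.
  by move/cvgrPdist_le : F_cont; apply.
by exists del.
Qed.

Lemma edist_le (q : nat) (u v : 'rV[R]_q) : Defs.edist _ u v <= q%:R * `|u - v|.
Proof.
rewrite /Defs.edist -[leRHS]ger0_norm ?mulr_ge0// -sqrtr_sqr ler_wsqrtr//.
have -> : \sum_i (u 0 i - v 0 i) ^+ 2 = \sum_i (u - v) 0 i ^+ 2.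
  by apply: eq_bigr => i _; rewrite !mxE.
rewrite (le_trans (sum_sqr_le_rV_norm _))// exprMn ler_wpM2r ?sqr_ge0//.
by rewrite -natrX ler_nat; case: q {u v} => // q; rewrite -mulnn leq_pmulr.
Qed.

Lemma continuous_chart_cont_on (k q : nat) (F : 'rV[R]_k * R -> 'rV[R]_q)
    (Z : set (R * 'rV[R]_k.+1)) :
  continuous F -> Z `<=` Hyp k.+1 -> cont_on _ _ Z (F \o @chart k).
Proof.
move=> F_cont ZH p /ZH Hp eps eps_gt0.
have e_gt0 : 0 < eps / q.+1%:R by rewrite divr_gt0.
(* The cast gives access to the normed module structure of [R]. *)
have [del del_gt0 F_le] := @continuous_at_norm R ('rV[R]_k * (R : realType))%type
  'rV[R]_q F _ _ (F_cont (chart p)) e_gt0.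
have [eta eta_gt0 chart_near] := hdist_chart_continuous Hp del_gt0.
exists eta => // p' /ZH Hp' /(chart_near _ Hp')/F_le{}F_le.
apply: (le_lt_trans (edist_le _ _)).
apply: (@le_lt_trans _ _ (q%:R * (eps / q.+1%:R))); first exact: ler_wpM2l.
by rewrite mulrCA gtr_pMr// ltr_pdivrMr// mul1r ltr_nat.
Qed.

Section fibered.
Context (K : realType) (r m : nat).
Implicit Types (u : 'rV[K]_(r + m) * K) (h : 'rV[K]_m * K -> K).

Definition drop_horizontal u : 'rV[K]_m * K := (rsubmx u.1, u.2).

Definition fibered h u : 'rV[K]_(1 + r) :=
  row_mx (h (drop_horizontal u))%:M (lsubmx u.1).

Lemma horizontal_coord_continuous (j : 'I_(r + m)) : continuous (fun u => u.1 0 j).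
Proof.
move=> u.
have fst_cont : {for u, continuous (@fst 'rV[K]_(r + m) K)} by exact: cvg_fst.
exact: (continuous_comp fst_cont (@coord_continuous _ _ _ 0 j u.1)).
Qed.

Lemma drop_horizontal_continuous : continuous drop_horizontal.
Proof.
have rsub_cont : continuous (fun u => rsubmx u.1).
  apply: rV_continuous => i.
  have -> : (fun u => rsubmx u.1 0 i) = (fun u => u.1 0 (rshift r i)).
    by apply/funext => u; rewrite mxE.
  exact: horizontal_coord_continuous.
by move=> u; apply: cvg_pair (rsub_cont u) cvg_snd.
Qed.

Lemma fibered_continuous h : continuous h -> continuous (fibered h).
Proof.
move=> h_cont; apply: rV_continuous => i; case: (split_ordP i) => j ->.
  have -> : (fun u => fibered h u 0 (lshift r j)) = h \o drop_horizontal.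
    by apply/funext => u; rewrite row_mxEl mxE ord1 eqxx mulr1n.
  move=> u; apply: continuous_comp; first exact: drop_horizontal_continuous.
  exact: h_cont.
have -> : (fun u => fibered h u 0 (rshift 1 j)) = (fun u => u.1 0 (lshift m j)).
  by apply/funext => u; rewrite row_mxEr mxE.
exact: horizontal_coord_continuous.
Qed.

Lemma drop_horizontal_contract u u' :
  `|drop_horizontal u - drop_horizontal u'| <= `|u - u'|.
Proof.
rewrite [leLHS]prod_normE [leRHS]prod_normE ge_max !le_max lexx orbT andbT.
apply/orP; left; apply/rV_norm_le => [|i]; first exact: normr_ge0.
by rewrite !mxE; have := coord_le_rV_norm (u.1 - u'.1) (rshift r i); rewrite !mxE.
Qed.

End fibered.

Section upper_bound.
Context (r m : nat).
Local Notation d := (r + m).+1.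
Local Notation q := r.+1.
Local Notation center := (center R).
Local Notation shadow p := (drop_horizontal (@chart (r + m) p)).
Implicit Types (p : R * 'rV[R]_d) (Z : set (R * 'rV[R]_d)) (Q : cell m)
  (v : 'rV[R]_r) (h : 'rV[R]_m * R -> R).

Definition lift_center v Q : R * 'rV[R]_d :=
  hpoint (row_mx v (center Q).1, (center Q).2).

Lemma Hyp_lift_center v Q : Hyp d (lift_center v Q).
Proof. by apply: Hyp_hpoint; exact: center2_gt0. Qed.

Lemma hdist_lift_center_le1 p v Q : Hyp d p -> lsubmx (chart p).1 = v ->
  region Q (shadow p) -> hdist d (lift_center v Q) p <= 1.
Proof.
move=> Hp pv [horizontal vertical]; apply: hdist_le1 => //.
  exact: Hyp_lift_center.
rewrite lor_chart//; last exact: Hyp_lift_center.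
have -> : hgt (lift_center v Q) = (center Q).2.
  by rewrite -[LHS]/(chart (lift_center v Q)).2 hpointK ?center2_gt0.
have -> : \sum_i ((chart (lift_center v Q)).1 - (chart p).1) 0 i ^+ 2 =
    \sum_i (rsubmx (chart p).1 - (center Q).1) 0 i ^+ 2.
  rewrite hpointK ?center2_gt0// -[(chart p).1]hsubmxK pv row_mxKr.
  rewrite opp_row_mx add_row_mx subrr big_split_ord /= big1 ?add0r => [|i _].
    by apply: eq_bigr => i _; rewrite row_mxEr !mxE -sqrrN opprB.
  by rewrite row_mxEl mxE expr0n.
have lor_le (S l y : R) : 0 < l -> S <= l ^+ 2 / 4 -> `|y - 3 / 2 * l| <= l / 2 ->
    1 + (S + (3 / 2 * l - y) ^+ 2) / (2 * (3 / 2 * l) * y) <= 5 / 4.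
  move=> l_gt0 S_le; rewrite ler_norml => /andP[y_ge y_le].
  have y_gt0 : 0 < y by lra.
  by rewrite -lerBrDl ler_pdivrMr ?mulr_gt0//; nra.
exact: lor_le (side_gt0 R Q) (sum_sqr_le_side horizontal) vertical.
Qed.

Lemma Cov1_fiber_le h Z (P : seq (cell m)) (B : R) (z : 'rV[R]_q) :
  Z `<=` Hyp d -> (forall p Q, Z p -> region Q (shadow p) -> Q \in P) ->
  (forall c, (count (crosses h c) P)%:R <= B) ->
  (Cov1 d [set p | Z p /\ fibered h (chart p) = z] <= B%:E)%E.
Proof.
move=> ZH ZP h_le; pose c := lsubmx (z : 'rV_(1 + r)) 0 0.
pose v := rsubmx (z : 'rV_(1 + r)).
pose cs := [seq lift_center v Q | Q <- P & crosses h c Q].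
apply: (@le_trans _ _ (size cs)%:R%:E); last first.
  by rewrite lee_fin size_map size_filter.
apply: ereal_inf_lbound; exists (size cs) => //; exists cs; split=> //; split.
  by move=> _ /mapP[Q _ ->]; exact: Hyp_lift_center.
move=> p [Zp pz]; have Hp := ZH _ Zp.
have pc : h (shadow p) = c by rewrite /c -pz row_mxKl mxE eqxx.
have pv : lsubmx (chart p).1 = v by rewrite /v -pz row_mxKr.
have [Q Qp] := @exists_region _ _ (shadow p) (hgt_gt0 Hp).
exists (lift_center v Q); last exact: hdist_lift_center_le1.
apply: map_f; rewrite mem_filter (ZP p)// andbT.
by apply/mem_set; exists (shadow p).
Qed.

Lemma exists_cell_cover Z (n : nat) : Z `<=` Hyp d -> Defs.covered_by d Z n ->
  exists P : seq (cell m), [/\ uniq P, (size P <= n * ball_cell_number m)%N &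
    forall p Q, Z p -> region Q (shadow p) -> Q \in P].
Proof.
move=> ZH [cs [size_cs [Hcs cover]]].
have /choice[near nearP] : forall c : R * 'rV[R]_d, exists s : seq (cell m),
    (size s <= ball_cell_number m)%N /\ (Hyp d c -> forall p Q, Hyp d p ->
      hdist d c p <= 1 -> region Q (shadow p) -> Q \in s).
  move=> c; have [Hc|] := pselect (Hyp d c); last by exists [::].
  have [s size_s sP] := @exists_ball_cells _ _ (shadow c) (hgt_gt0 Hc).
  exists s; split=> // _ p Q Hp /(hdist_le1_chart Hc Hp)[hgt_le chart_le].
  by apply: sP => //; apply: le_trans (drop_horizontal_contract _ _) chart_le.
exists (undup (flatten [seq near c | c <- cs])); split; first exact: undup_uniq.
  rewrite (leq_trans (size_undup _))//.
  apply: leq_trans (size_flatten_map_le _ (fun c => (nearP c).1)) _.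
  by rewrite leq_mul2r size_cs orbT.
move=> p Q Zp Qp; have [c c_cs cp] := cover _ Zp.
rewrite mem_undup; apply/flattenP; exists (near c); first exact: map_f.
exact: (nearP c).2 (Hcs _ c_cs) p Q (ZH _ Zp) cp Qp.
Qed.

Lemma TO_le_Cov1 Z (t B : R) : Z `<=` Hyp d -> (Cov1 d Z <= t%:E)%E ->
  (forall P : seq (cell m), uniq P ->
     (size P)%:R <= (ball_cell_number m)%:R * (t + 1) -> sweepable P B) ->
  (TO d q Z <= B%:E)%E.
Proof.
move=> ZH Zt sweepP.
have : (Cov1 d Z < (t + 1)%:E)%E by rewrite (le_lt_trans Zt)// lte_fin; lra.
move=> /ereal_inf_lt[_ [n /(exists_cell_cover ZH)[P [uP size_P ZP]] <-]].
rewrite lte_fin => n_lt.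
have size_le : (size P)%:R <= (ball_cell_number m)%:R * (t + 1).
  apply: (@le_trans _ _ (n * ball_cell_number m)%:R); first by rewrite ler_nat.
  by rewrite natrM mulrC ler_wpM2l// ltW.
have [h [h_cont _ h_le]] := sweepP P uP size_le.
apply: (@le_trans _ _ (Ov d q Z (fibered h \o @chart (r + m)))).
  apply: ereal_inf_lbound; exists (fibered h \o @chart (r + m)) => //.
  by apply: continuous_chart_cont_on => //; exact: fibered_continuous.
by apply: ge_ereal_sup => _ [z _ <-]; exact: Cov1_fiber_le h_le.
Qed.

Lemma lesssim_TOX (G : R -> R) (A : R) : 0 <= A -> 0 <= G 0 ->
  {in Num.nneg &, {homo G : s t / s <= t}} ->
  absorbs_separators m (fun N => A * G N%:R) -> lesssim (TOX d q) G.
Proof.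
move=> A_ge0 G0_ge0 G_homo absorb; pose M : R := (ball_cell_number m)%:R.
have G_le s t : 0 <= s -> s <= t -> G s <= G t.
  by move=> s_ge0 st; apply: G_homo; rewrite ?nnegrE// (le_trans s_ge0).
have G_ge0 t : 0 <= t -> 0 <= G t by move=> /(G_le 0 _ (lexx _)); apply: le_trans.
have M_ge0 : 0 <= M by [].
pose B : R := (small_size m)%:R; have B_ge0 : 0 <= B by [].
have AG_ge0 : 0 <= A * G (2 * M) by rewrite mulr_ge0 ?G_ge0 ?mulr_ge0.
pose C := A + 2 * M + B + A * G (2 * M) + 1.
exists C; split=> [|t t_ge0]; first by rewrite /C; lra.
apply: ge_ereal_sup => _ [Z [ZH Zt] <-].
apply: (TO_le_Cov1 ZH Zt) => P uP; rewrite -/M => size_le.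
apply: sweepable_le (absorbs_separators_sweepable _ absorb uP) => [|N]; last first.
  by rewrite mulr_ge0 ?G_ge0.
have GC_ge0 : 0 <= C * G (C * t) by rewrite mulr_ge0 ?G_ge0 ?mulr_ge0// /C; lra.
rewrite -/B; have [t_le1|t_ge1] := leP t 1.
  have /(ler_wpM2l A_ge0) : G (size P)%:R <= G (2 * M) by apply: G_le => //; nra.
  by move: GC_ge0; rewrite /C; lra.
have G_size : G (size P)%:R <= G (C * t).
  apply: G_le => //; apply: (le_trans size_le).
  apply: (@le_trans _ _ (2 * M * t)); first by nra.
  by rewrite ler_wpM2r// /C; lra.
have AC : A <= C by rewrite /C; lra.
have : A * G (size P)%:R <= C * G (C * t) by apply: ler_pM => //; exact: G_ge0.
by rewrite /C; lra.
Qed.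

End upper_bound.

Theorem theorem1p12 :
  (forall d q : nat, (2 <= q)%N -> (q + 2 <= d)%N ->
     lesssim (TOX d q) (fun r => r `^ (1 - ((d - q)%:R)^-1))) /\
  (forall d : nat, (2 <= d)%N ->
     lesssim (TOX d (d - 1)) (fun r => ln (1 + r) ^+ 2)).
Proof.
split=> [d [//|r] _ rd|d d_ge2].
  pose m := (d - r.+1)%N; have m_gt1 : (1 < m)%N by rewrite /m; lia.
  have -> : d = (r + m).+1 by rewrite /m; lia.
  rewrite subSS addKn.
  have [A A_ge0 absorb] := absorbs_separators_power R m_gt1.
  apply: (lesssim_TOX r A_ge0 _ _ absorb); first exact: powR_ge0.
  by apply: ge0_ler_powR; rewrite subr_ge0 invf_le1 ?ler1n ?ltr0n; lia.
have -> : d = (d - 2 + 1).+1 by lia.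
have -> : ((d - 2 + 1).+1 - 1 = (d - 2).+1)%N by lia.
have [A A_ge0 absorb] := absorbs_separators_sqr_log R.
apply: (lesssim_TOX (d - 2) A_ge0 _ _ absorb) => [|s t]; first exact: sqr_ge0.
rewrite !nnegrE => s_ge0 t_ge0 st.
have ln_s : 0 <= ln (1 + s) by rewrite ln_ge0//; lra.
have ln_st : ln (1 + s) <= ln (1 + t) by rewrite ler_ln ?posrE; lra.
by rewrite lerXn2r ?nnegrE// (le_trans ln_s).
Qed.
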